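(* Let $\Gamma_1$ and $\Gamma_2$ be finite simplicial graphs with the same $f$-polynomial, such that $|\mathrm{Lk}(\sigma)|=|\mathrm{Lk}(\sigma')|$ for all $\sigma\in\mathcal{A}(\Gamma_1)$ and $\sigma'\in\mathcal{A}(\Gamma_2)$ with $|\sigma|=|\sigma'|$. Then the right-angled Artin groups $G_1$ and $G_2$ based on $\Gamma_1$ and $\Gamma_2$ have the same geodesic growth with respect to their standard generating sets.
   Context: For a finite simplicial graph $\Gamma$ with vertex set $V\Gamma$ and edge set $E\Gamma$, $\mathcal{A}(\Gamma)$ is the set of non-empty subsets $\sigma\subseteq V\Gamma$ whose vertices span a complete subgraph (clique); the size of $\sigma$ is $|\sigma|$. For $\sigma\in\mathcal{A}(\Gamma)$, $\mathrm{Lk}(\sigma)=\{v\in V\Gamma\setminus\sigma : \{v\}\cup\sigma\in\mathcal{A}(\Gamma)\}$. The $f$-polynomial of $\Gamma$ is $f(t)=1+f_0t+f_1t^2+\cdots$, where $f_i$ is the number of cliques of size $i+1$ in $\Gamma$. The right-angled Artin group based on $\Gamma$ is $\langle s\in V\Gamma \mid ss'=s's\ \forall \{s,s'\}\in E\Gamma\rangle$. The geodesic growth function of such a group $G$ counts, for each $r\ge 0$, the geodesics of length $r$ starting at $1$ in the Cayley graph of $G$ with respect to $V\Gamma$; equivalently, the number of words $w$ of length $r$ over the alphabet $V\Gamma\sqcup (V\Gamma)^{-1}$ such that the element of $G$ represented by $w$ has word length $r$ with respect to $V\Gamma\cup(V\Gamma)^{-1}$. Two groups have the same geodesic growth if these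 functions coincide. *)

(* Defs.v *)
From HB Require Import structures.
From mathcomp Require Import all_boot all_algebra generic_quotient boolp.

Set Implicit Arguments.
Unset Strict Implicit.
Unset Printing Implicit Defensive.

Import GRing.Theory.
Local Open Scope quotient_scope.

Record sgraph := SGraph {
  vertex :> finType;
  adj : rel vertex;
  adj_sym : symmetric adj;
  adj_irrefl : irreflexive adj
}.

Section Cliques.
Variable Gamma : sgraph.
Implicit Type sigma : {set Gamma}.

(* All cliques are non-empty. *)
Definition cliques : {set {set Gamma}} :=
  [set sigma | (sigma != set0) &&
     [forall u in sigma, forall v in sigma, (u != v) ==> adj u v]].

Definition link sigma : {set Gamma} :=
  [set v | (v \notin sigma) && (v |: sigma \in cliques)].

Definition fnum (i : nat) : nat := #|[set sigma in cliques | #|sigma| == i.+1]|.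

(* fnum i = 0 for i >= #|Gamma|, so the finite sum has all the terms. *)
Definition fpoly : {poly int} :=
  (1 + \sum_(i < #|Gamma|) (fnum i)%:R *: 'X^(i.+1))%R.

End Cliques.

(* (x, true) stands for the generator x and (x, false) for its inverse. *)
Definition letter (X : Type) : Type := (X * bool)%type.
HB.instance Definition _ (X : choiceType) := Choice.on (letter X).
HB.instance Definition _ (X : finType) := Finite.on (letter X).

Definition inv_letter X (l : letter X) : letter X := (l.1, ~~ l.2).

Definition inv_word X (w : seq (letter X)) : seq (letter X) :=
  rev (map (@inv_letter X) w).

Lemma inv_letterK X : involutive (@inv_letter X).
Proof. by case=> x b; rewrite /inv_letter /= negbK. Qed.

(* The group < X | u = v for all u, v with R u v >. *)
Section Presentation.
Variables (X : choiceType) (R : seq (letter X) -> seq (letter X) -> Prop).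

Inductive pres_eq : seq (letter X) -> seq (letter X) -> Prop :=
| pres_refl u : pres_eq u u
| pres_sym u v : pres_eq u v -> pres_eq v u
| pres_trans u v w : pres_eq u v -> pres_eq v w -> pres_eq u w
| pres_cat u u' v v' :
    pres_eq u u' -> pres_eq v v' -> pres_eq (u ++ v) (u' ++ v')
| pres_cancel l : pres_eq [:: l; inv_letter l] [::]
| pres_rel u v : R u v -> pres_eq u v.

Definition pres_eqb (u v : seq (letter X)) : bool := `[< pres_eq u v >].

Lemma pres_eqb_refl : reflexive pres_eqb.
Proof. by move=> u; apply/asboolP; exact: pres_refl. Qed.

Lemma pres_eqb_sym : symmetric pres_eqb.
Proof. by move=> u v; apply/asboolP/asboolP; exact: pres_sym. Qed.

Lemma pres_eqb_trans : transitive pres_eqb.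
Proof.
move=> v u w /asboolP uv /asboolP vw; apply/asboolP; exact: pres_trans uv vw.
Qed.

Canonical pres_equiv :=
  EquivRel pres_eqb pres_eqb_refl pres_eqb_sym pres_eqb_trans.

Definition presented : Type := {eq_quot pres_equiv}.
HB.instance Definition _ := Choice.on presented.

Definition pres_class (w : seq (letter X)) : presented :=
  \pi_({eq_quot pres_equiv}) w.

Definition pres_repr (g : presented) : seq (letter X) :=
  repr (g : {eq_quot pres_equiv}).

Lemma pres_reprK : cancel pres_repr pres_class.
Proof. by move=> g; rewrite /pres_class /pres_repr reprK. Qed.

Lemma pres_classP u v : pres_class u = pres_class v <-> pres_eq u v.
Proof.
split=> [/(@eqmodP _ pres_equiv)/asboolP // | uv].
by apply/(@eqmodP _ pres_equiv)/asboolP.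
Qed.

Lemma pres_repr_class u : pres_eq (pres_repr (pres_class u)) u.
Proof. by apply/pres_classP; rewrite pres_reprK. Qed.

Lemma pres_catV u : pres_eq (u ++ inv_word u) [::].
Proof.
elim: u => [|l u IHu]; first exact: pres_refl.
have -> : (l :: u) ++ inv_word (l :: u) =
    [:: l] ++ ((u ++ inv_word u) ++ [:: inv_letter l]).
  by rewrite /inv_word /= rev_cons -cats1 catA.
apply: pres_trans (pres_cancel l).
rewrite -[X in pres_eq _ X]/([:: l] ++ ([::] ++ [:: inv_letter l])).
by apply: pres_cat; [exact: pres_refl | apply: pres_cat IHu (pres_refl _)].
Qed.

Lemma inv_wordK : involutive (@inv_word X).
Proof.
by move=> u; rewrite /inv_word map_rev revK mapK //; exact: inv_letterK.
Qed.

Lemma pres_Vcat u : pres_eq (inv_word u ++ u) [::].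
Proof. by rewrite -{2}[u]inv_wordK; exact: pres_catV. Qed.

Lemma pres_inv u v : pres_eq u v -> pres_eq (inv_word u) (inv_word v).
Proof.
move=> uv; apply: (@pres_trans _ (inv_word u ++ (v ++ inv_word v))).
  rewrite -{1}[inv_word u]cats0.
  by apply: pres_cat (pres_refl _) (pres_sym (pres_catV v)).
rewrite catA -[X in pres_eq _ X]cat0s; apply: pres_cat (pres_refl _).
apply: pres_trans (pres_Vcat u).
by apply: pres_cat (pres_refl _) (pres_sym uv).
Qed.

Definition pres_one : presented := pres_class [::].
Definition pres_mul (g h : presented) : presented :=
  pres_class (pres_repr g ++ pres_repr h).
Definition pres_invg (g : presented) : presented :=
  pres_class (inv_word (pres_repr g)).

Lemma pres_mulE u v :
  pres_mul (pres_class u) (pres_class v) = pres_class (u ++ v).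
Proof. by apply/pres_classP; apply: pres_cat; exact: pres_repr_class. Qed.

Lemma pres_invE u : pres_invg (pres_class u) = pres_class (inv_word u).
Proof. by apply/pres_classP; apply: pres_inv; exact: pres_repr_class. Qed.

Lemma pres_mulA : associative pres_mul.
Proof.
move=> g h k; rewrite -(pres_reprK g) -(pres_reprK h) -(pres_reprK k).
by rewrite !pres_mulE catA.
Qed.

Lemma pres_1mul : left_id pres_one pres_mul.
Proof. by move=> g; rewrite -(pres_reprK g) pres_mulE. Qed.

Lemma pres_mul1 : right_id pres_one pres_mul.
Proof. by move=> g; rewrite -(pres_reprK g) pres_mulE cats0. Qed.

Lemma pres_Vmul : left_inverse pres_one pres_invg pres_mul.
Proof.
move=> g; rewrite -(pres_reprK g) pres_invE pres_mulE.
by apply/pres_classP; exact: pres_Vcat.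
Qed.

Lemma pres_mulV : right_inverse pres_one pres_invg pres_mul.
Proof.
move=> g; rewrite -(pres_reprK g) pres_invE pres_mulE.
by apply/pres_classP; exact: pres_catV.
Qed.

HB.instance Definition _ := isGroup.Build presented
  pres_mulA pres_1mul pres_mul1 pres_Vmul pres_mulV.

Definition pres_gen (x : X) : presented := pres_class [:: (x, true)].

End Presentation.

Section GeodesicGrowth.
Variables (X : finType) (G : groupType) (s : X -> G).
Local Open Scope group_scope.

Definition letter_eval (l : letter X) : G := if l.2 then s l.1 else (s l.1)^-1.

Definition word_eval (w : seq (letter X)) : G :=
  foldr (fun l g => letter_eval l * g) 1 w.

Definition has_word_length (g : G) (n : nat) : Prop :=
  (exists2 w, word_eval w = g & size w = n) /\
  (forall w, word_eval w = g -> (n <= size w)%N).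

Definition geodesic (w : seq (letter X)) : Prop :=
  has_word_length (word_eval w) (size w).

Definition geodesic_growth (r : nat) : nat :=
  #|[set w : r.-tuple (letter X) | `[< geodesic w >]]|.

End GeodesicGrowth.

Lemma word_eval_cat (X : finType) (G : groupType) (s : X -> G) u v :
  word_eval s (u ++ v) = (word_eval s u * word_eval s v)%g.
Proof. by elim: u => [|l u IHu] /=; rewrite ?mul1g // IHu mulgA. Qed.

Lemma word_eval_pres_gen (X : finType) R (w : seq (letter X)) :
  word_eval (@pres_gen X R) w = pres_class R w.
Proof.
elim: w => //= l w ->; rewrite -[l :: w]cat1s -pres_mulE; congr (pres_mul _ _).
case: l => x [] //=; rewrite /letter_eval /=.
exact: (pres_invE R [:: (x, true)]).
Qed.

(* Universal property of the presentation. *)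
Lemma pres_eq_eval (X : finType) R (G : groupType) (s : X -> G) :
  (forall u v, R u v -> word_eval s u = word_eval s v) ->
  forall u v, pres_eq R u v -> word_eval s u = word_eval s v.
Proof.
move=> sP u v; elim=> {u v} //.
- by move=> u v w _ -> _ ->.
- by move=> u u' v v' _ eu _ ev; rewrite !word_eval_cat eu ev.
by case=> x [] /=; rewrite /letter_eval /= mulg1 ?mulgV ?mulVg.
Qed.

Inductive raag_rel (Gamma : sgraph) :
    seq (letter Gamma) -> seq (letter Gamma) -> Prop :=
| RaagRel (u v : Gamma) : adj u v ->
    raag_rel [:: (u, true); (v, true)] [:: (v, true); (u, true)].

Definition raag (Gamma : sgraph) : groupType := presented (@raag_rel Gamma).

Definition raag_gen (Gamma : sgraph) : Gamma -> raag Gamma :=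
  @pres_gen Gamma (@raag_rel Gamma).

(* Main.v *)
Require Import Defs.
From mathcomp Require Import all_boot all_algebra.
From mathcomp Require Import boolp.

Set Implicit Arguments.
Unset Strict Implicit.
Unset Printing Implicit Defensive.

(** Geodesics of a right-angled Artin group are recognised letter by letter.
A word is geodesic exactly when it never contains a letter [m] followed,
across letters that all commute with it, by the inverse of [m]
([geodesicP]).  Hence whether a geodesic can be continued by a letter [l] is
decided by the set of letters that can be shuffled to its end: [l] is
refused exactly when its inverse is among them.  The vertices of these
letters form a clique [sigma] (or the empty set), and reading a letter with
vertex [x] turns [sigma] into [x] together with the neighbours of [x] in
[sigma].

The number of geodesic continuations of given length therefore depends on
[#|sigma|] only, provided that for each [n] the number of vertices [x] with
[#|sigma :&: nbr x| = n] depends on [#|sigma|] only ([card_next_level],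
[eq_extensions]).  Sorting these [x] by their trace [tau] on [sigma], one has
to count the vertices adjacent to all of [tau] and to none of
[sigma :\: tau].  Inclusion-exclusion reduces this to counting the common
neighbours of the subsets of [sigma] ([eq_card_pattern]); for a nonempty
clique they form its link, whose size is prescribed, and for the empty set
they are all the vertices, whose number is the linear coefficient of the
f-polynomial.

That the local condition implies being geodesic is where the group itself
enters.  Letters act on the words satisfying the condition, by cancelling
against an inverse when possible and by being appended otherwise; up to
shuffling this action respects the relations of the group
([foldl_act_pres_eq]).  A word that satisfies the condition is what its own
letters build from the empty word, so any other word for the same element
builds a shuffle of it, and thus needs at least as many letters. *)

Import GRing.Theory Num.Theory.

(** * Reduced words *)

Section Stacks.
Variable Gamma : sgraph.
Implicit Types (x y : Gamma) (l m k : letter Gamma) (s t : seq (letter Gamma)).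

(** A word is stored as a stack, its last letter at the head, so that the
letters that can be shuffled to the end of the word are found from the
head. *)
Fixpoint exposed m s : bool :=
  if s is l :: s' then (l == m) || adj m.1 l.1 && exposed m s' else false.

Fixpoint reduced s : bool :=
  if s is l :: s' then ~~ exposed (inv_letter l) s' && reduced s' else true.

Lemma exposed_mem m s : exposed m s -> m \in s.
Proof.
elim: s => //= l s IHs /orP[/eqP->|/andP[_ /IHs ms]]; rewrite inE ?eqxx //.
by rewrite ms orbT.
Qed.

(** The projections onto pairs of non-adjacent vertices determine a word up
to swaps of adjacent letters with adjacent vertices.  Taking their equality
as the definition of [shuffle] makes it visibly an equivalence, and turns
statements about swaps into computations on lists.  The case [x = y] records
the occurrences of a single vertex. *)
Definition proj x y s := [seq m <- s | (m.1 == x) || (m.1 == y)].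

Definition shuffle s t := forall x y, ~~ adj x y -> proj x y s = proj x y t.

Lemma shuffle_sym s t : shuffle s t -> shuffle t s.
Proof. by move=> st x y xy; rewrite st. Qed.

Lemma shuffle_trans s t u : shuffle s t -> shuffle t u -> shuffle s u.
Proof. by move=> st tu x y xy; rewrite st // tu. Qed.

Lemma shuffle_size s t : shuffle s t -> size s = size t.
Proof.
move=> st; apply/perm_size/allP => m _ /=; apply/eqP.
have cE u : count_mem m u = count_mem m (proj m.1 m.1 u).
  rewrite count_filter; apply: eq_count => k /=.
  by case: eqP => // ->; rewrite eqxx.
by rewrite (cE s) (cE t) st // adj_irrefl.
Qed.

(** Thus being exposed depends only on the word up to shuffling, and only on
the projections that involve the vertex of [m]. *)
Lemma exposedP m s :
  reflect (forall y, ~~ adj m.1 y -> ohead (proj m.1 y s) = Some m)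
          (exposed m s).
Proof.
elim: s => [|l s IHs] /=.
  by constructor=> /(_ m.1); rewrite adj_irrefl => /(_ isT).
have [->|lm] := eqVneq l m; first by constructor=> y _; rewrite eqxx.
have [ml|ml] /= := boolP (adj m.1 l.1); last first.
  constructor=> /(_ l.1 ml); rewrite eqxx orbT /= => -[lE].
  by rewrite lE eqxx in lm.
have skip y : ~~ adj m.1 y -> (l.1 == m.1) || (l.1 == y) = false.
  by move=> my; apply/norP; split; apply: contraTneq ml => ->;
    rewrite ?adj_irrefl.
apply: (iffP IHs) => h y my; first by rewrite skip ?h.
by have := h y my; rewrite skip.
Qed.

Lemma eq_exposed m s t :
    (forall y, ~~ adj m.1 y -> proj m.1 y s = proj m.1 y t) ->
  exposed m s = exposed m t.
Proof.
by move=> st; apply/exposedP/exposedP => h y my; rewrite -(h y my) st.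
Qed.

Lemma shuffle_exposed s t m : shuffle s t -> exposed m s = exposed m t.
Proof. by move=> st; apply: eq_exposed => y; exact: st. Qed.

Lemma shuffle_rem m s : exposed m s -> shuffle (m :: rem m s) s.
Proof.
move=> ms x y xy; elim: s ms => //= l s IHs.
case: eqP => [-> //|_] /= /andP[ml /IHs{IHs} <-] /=.
have [mxy|//] := boolP ((m.1 == x) || (m.1 == y)).
suff -> : (l.1 == x) || (l.1 == y) = false by [].
apply/norP; split; apply: contraNneq xy => lE; rewrite lE in ml.
  by case/orP: mxy => /eqP mE; rewrite mE ?adj_irrefl // adj_sym in ml *.
by case/orP: mxy => /eqP mE; rewrite mE ?adj_irrefl // in ml *.
Qed.

(** Once the last [m] is cancelled, an exposed inverse of [m] would have stood
before that [m] with only commuting letters in between. *)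
Lemma reduced_rem_exposed m s :
  reduced s -> exposed m s -> ~~ exposed (inv_letter m) (rem m s).
Proof.
elim: s => //= l s IHs /andP[ls rs]; case: eqP => [<- //|_] /=.
case/andP=> ml /(IHs rs)/negPf-> /=; rewrite andbF orbF.
by apply: contraTneq ml => ->; rewrite adj_irrefl.
Qed.

Lemma reduced_rem m s : reduced s -> exposed m s -> reduced (rem m s).
Proof.
elim: s => //= l s IHs /andP[ls rs]; case: eqP => //= _ /andP[ml ms].
rewrite IHs // andbT; apply: contra ls => lms.
by rewrite -(shuffle_exposed _ (shuffle_rem ms)) /= lms adj_sym ml orbT.
Qed.

(** * The action of the group on reduced words *)

Definition act s l :=
  if exposed (inv_letter l) s then rem (inv_letter l) s else l :: s.

Lemma reduced_act s l : reduced s -> reduced (act s l).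
Proof.
by rewrite /act; case: ifPn => [/reduced_rem h /h //|/= -> ->].
Qed.

Lemma size_act s l : size (act s l) <= (size s).+1.
Proof.
rewrite /act; case: ifP => // /exposed_mem ls.
by rewrite size_rem // (leq_trans (leq_pred _)).
Qed.

Lemma proj_act s l x y : ~~ adj x y ->
  proj x y (act s l) =
    if (l.1 == x) || (l.1 == y) then
      if exposed (inv_letter l) s then behead (proj x y s)
      else l :: proj x y s
    else proj x y s.
Proof.
move=> xy; rewrite /act.
have [ls|_] := boolP (exposed (inv_letter l) s); last by [].
by rewrite -(shuffle_rem ls xy) /=; case: ((l.1 == x) || (l.1 == y)).
Qed.

Lemma shuffle_act s t l : shuffle s t -> shuffle (act s l) (act t l).
Proof.
by move=> st x y xy; rewrite !proj_act // (shuffle_exposed _ st) st.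
Qed.

Lemma act_cancel s l :
  reduced s -> shuffle (act (act s l) (inv_letter l)) s.
Proof.
move=> rs; rewrite {2}/act; case: ifP => [ls|_]; last first.
  by rewrite /act inv_letterK /= eqxx.
by rewrite /act ifN ?reduced_rem_exposed //; exact: shuffle_rem.
Qed.

Lemma exposed_act s l m : adj l.1 m.1 -> exposed m (act s l) = exposed m s.
Proof.
move=> lm; apply: eq_exposed => y my; rewrite proj_act //.
rewrite ifF //; apply/norP; split; apply: contraNneq my => lE.
  by rewrite lE adj_irrefl in lm.
by rewrite -lE adj_sym.
Qed.

(** The two letters modify disjoint families of projections, and neither
changes the projections that decide whether the other cancels. *)
Lemma act_commute s l k :
  adj l.1 k.1 -> shuffle (act (act s l) k) (act (act s k) l).
Proof.
move=> lk x y xy; rewrite !proj_act //.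
rewrite !exposed_act //; last by rewrite adj_sym.
case kxy: ((k.1 == x) || (k.1 == y)); case lxy: ((l.1 == x) || (l.1 == y)) => //.
case/negP: xy; case/orP: kxy lxy => /eqP<- /orP[] /eqP lE //.
- by rewrite lE adj_irrefl in lk.
- by rewrite adj_sym -lE.
- by rewrite -lE.
- by rewrite lE adj_irrefl in lk.
Qed.

Lemma reduced_foldl s w : reduced s -> reduced (foldl act s w).
Proof. by elim: w s => //= l w IHw s rs; exact/IHw/reduced_act. Qed.

Lemma size_foldl_act s w : size (foldl act s w) <= size s + size w.
Proof.
elim: w s => [|l w IHw] s /=; first by rewrite addn0.
by rewrite (leq_trans (IHw _)) // addnS -addSn leq_add2r size_act.
Qed.

Lemma shuffle_foldl s t w :
  shuffle s t -> shuffle (foldl act s w) (foldl act t w).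
Proof. by elim: w s t => //= l w IHw s t st; exact/IHw/shuffle_act. Qed.

(** Starting from a reduced word matters for [pres_cancel] only: on a word
that ends with a letter and its inverse, cancelling twice would not restore
the word. *)
Lemma foldl_act_pres_eq u v : pres_eq (@raag_rel Gamma) u v ->
  forall s, reduced s -> shuffle (foldl act s u) (foldl act s v).
Proof.
elim=> {u v} [u|u v _ IH|u v w _ IHuv _ IHvw|u u' v v' _ IHu _ IHv|l|u v uv] s rs.
- by [].
- exact/shuffle_sym/IH.
- exact: shuffle_trans (IHuv s rs) (IHvw s rs).
- rewrite !foldl_cat; apply: shuffle_trans (IHv _ (reduced_foldl _ rs)).
  exact/shuffle_foldl/IHu.
- exact: act_cancel.
- by case: uv => x y xy; exact: (@act_commute s (x, true) (y, true)).
Qed.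

Lemma reduced_catrev w s : reduced (catrev w s) -> reduced s.
Proof. by elim: w s => //= l w IHw s /IHw /= /andP[]. Qed.

Lemma foldl_act_reduced w s :
  reduced (catrev w s) -> foldl act s w = catrev w s.
Proof.
elim: w s => //= l w IHw s rlw; rewrite -IHw //; congr (foldl _ _ _).
by have /= /andP[/negPf ls _] := reduced_catrev rlw; rewrite /act ls.
Qed.

(** * Geodesics are the reduced words *)

(** The relations only mention positive letters; in a group, commutation
passes to inverses. *)
Lemma pres_eq_swap l k :
  adj l.1 k.1 -> pres_eq (@raag_rel Gamma) [:: l; k] [:: k; l].
Proof.
move=> lk; apply/pres_classP; rewrite -!word_eval_pres_gen /= !mulg1.
have gens : commute (@raag_gen Gamma l.1) (raag_gen k.1).
  rewrite /commute; apply: etrans (pres_mulE _ _ _) _.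
  apply: etrans _ (esym (pres_mulE _ _ _)); apply/pres_classP.
  exact/pres_rel/RaagRel.
have half (g : raag Gamma) : commute g (raag_gen k.1) ->
    commute g (letter_eval (@raag_gen Gamma) k).
  by rewrite /letter_eval; case: k.2 => // /commuteV.
apply: half; rewrite /letter_eval; case: l.2 => //.
by apply/commute_sym/commuteV/commute_sym.
Qed.

Lemma pres_eq_exposed m s : exposed m s ->
  pres_eq (@raag_rel Gamma) (rev s) (rev (rem m s) ++ [:: m]).
Proof.
elim: s => //= l s IHs; case: eqP => [-> _|_ /= /andP[ml ms]].
  by rewrite rev_cons -cats1; exact: pres_refl.
rewrite !rev_cons -!cats1; apply: pres_trans (pres_cat (IHs ms) (pres_refl _ _)) _.
by rewrite -!catA; apply: pres_cat (pres_refl _ _) (pres_eq_swap _).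
Qed.

Lemma shorten_unreduced s : ~~ reduced s ->
  exists2 w, pres_eq (@raag_rel Gamma) (rev s) w & size w < size s.
Proof.
elim: s => //= l s IHs; rewrite rev_cons -cats1.
have [ls _|_ /= /IHs[w sw ltw]] := boolP (exposed (inv_letter l) s).
  exists (rev (rem (inv_letter l) s)); last first.
    by rewrite size_rev size_rem ?exposed_mem // ltnS leq_pred.
  apply: pres_trans (pres_cat (pres_eq_exposed ls) (pres_refl _ _)) _.
  rewrite -catA -[X in pres_eq _ _ X]cats0; apply: pres_cat (pres_refl _ _) _.
  by rewrite -{2}[l]inv_letterK; exact: pres_cancel.
exists (w ++ [:: l]); first exact: pres_cat sw (pres_refl _ _).
by rewrite size_cat addn1.
Qed.

Lemma geodesicP w : geodesic (@raag_gen Gamma) w <-> reduced (rev w).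
Proof.
rewrite /geodesic /has_word_length; split=> [[_ geo]|rw].
  apply: contraT => /shorten_unreduced[v]; rewrite revK size_rev ltnNge.
  by move=> wv /negP[]; apply: geo; rewrite !word_eval_pres_gen;
    apply/pres_classP/pres_sym.
split=> [|v]; first by exists w.
rewrite !word_eval_pres_gen => /pres_classP vw.
have := foldl_act_pres_eq vw (isT : reduced [::]).
rewrite (@foldl_act_reduced w) // => /shuffle_size eqsz.
rewrite -(size_rev w) -[size (rev w)]eqsz.
exact: size_foldl_act.
Qed.

End Stacks.

(** * Equality of sums by comparing level sets *)

Section Levels.

(** When [a] and [b] have level sets of the same sizes there is a bijection
between their domains that matches their values, and [F] and [G] agree along
it.  Each nonempty level set on one side has a partner on the other, which
forces [F] and [G] to be constant on it. *)
Lemma eq_sum_levels (A B : finType) (P : pred A) (Q : pred B)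
    (a : A -> nat) (b : B -> nat) (F : A -> nat) (G : B -> nat) :
    (forall n, #|[set x | P x & a x == n]| = #|[set y | Q y & b y == n]|) ->
    (forall x y, P x -> Q y -> a x = b y -> F x = G y) ->
  \sum_(x | P x) F x = \sum_(y | Q y) G y.
Proof.
move=> eq_lev eqFG.
pose N := (\max_x a x + \max_y b y).+1.
have ltaN x : a x < N by rewrite ltnS (leq_trans (leq_bigmax x)) ?leq_addr.
have ltbN y : b y < N by rewrite ltnS (leq_trans (leq_bigmax y)) ?leq_addl.
rewrite (partition_big (fun x => Ordinal (ltaN x)) xpredT) //=.
rewrite [RHS](partition_big (fun y => Ordinal (ltbN y)) xpredT) //=.
apply: eq_bigr => n _; have := eq_lev n.
have levE (I : finType) (R : pred I) (c : I -> nat) (ltcN : forall i, c i < N)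
    (H : I -> nat) : \sum_(i | R i && (Ordinal (ltcN i) == n)) H i
                   = \sum_(i in [set i | R i & c i == n]) H i.
  by apply: eq_bigl => i; rewrite inE -val_eqE.
rewrite !levE; set A' := [set x | _ & _]; set B' := [set y | _ & _] => eqAB.
have [A0|[x0 x0A]] := set_0Vmem A'.
  move: eqAB; rewrite A0 cards0 => /esym/cards0_eq->.
  by rewrite !big_set0.
have [y0 y0B] : exists y, y \in B'.
  by apply/set0Pn; rewrite -card_gt0 -eqAB; apply/card_gt0P; exists x0.
have FE x y : x \in A' -> y \in B' -> F x = G y.
  by rewrite !inE => /andP[Px /eqP ax] /andP[Qy /eqP bn]; apply: eqFG; rewrite // ax.
rewrite (eq_bigr (fun=> G y0)) => [|x xA]; last exact: FE.
rewrite [RHS](eq_bigr (fun=> G y0)) => [|y yB]; last first.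
  by rewrite -(FE x0 y) // (FE x0 y0).
by rewrite !sum_nat_const eqAB.
Qed.

End Levels.

(** * Vertices with a prescribed trace on a clique *)

Section Patterns.
Variable Gamma : sgraph.
Implicit Types (x y : Gamma) (tau rho sigma : {set Gamma}).

Definition nbr x : {set Gamma} := [set y | adj x y].

(** Unlike [cliques], this includes the empty set, which is the state reached
by the empty word. *)
Definition complete sigma : bool :=
  [forall u in sigma, forall v in sigma, (u != v) ==> adj u v].

Lemma completeP sigma :
  reflect {in sigma &, forall u v, u != v -> adj u v} (complete sigma).
Proof.
apply: (iffP forall_inP) => [h u v us vs uv|h u us].
  by have /forall_inP/(_ v vs)/implyP := h u us; apply.
by apply/forall_inP => v vs; apply/implyP; exact: h.
Qed.

Lemma completeS tau sigma : tau \subset sigma -> complete sigma -> complete tau.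
Proof.
move=> /subsetP ts /completeP h; apply/completeP => u v /ts us /ts vs.
exact: h.
Qed.

Definition pattern tau rho : {set Gamma} :=
  [set x | (tau \subset nbr x) && (rho \subset ~: nbr x)].

Lemma card_pattern_split tau rho y :
  #|pattern tau rho| = #|pattern (y |: tau) rho| + #|pattern tau (y |: rho)|.
Proof.
rewrite -(cardsID [set x | adj x y]).
by congr (_ + _); apply: eq_card => x; rewrite !inE !subUset !sub1set !inE;
  case: (adj x y); rewrite ?andbT ?andbF.
Qed.

Lemma pattern_link tau :
  tau != set0 -> complete tau -> pattern tau set0 = link tau.
Proof.
move=> nt0 /completeP ct; apply/setP => x; rewrite !inE sub0set andbT.
apply/subsetP/idP => [tx|/and3P[xt _ /completeP xc] y yt]; last first.
  by rewrite inE; apply: xc; rewrite ?inE ?eqxx ?yt ?orbT //;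
    apply: contraNneq xt => ->.
have xt : x \notin tau.
  by apply/negP => /tx; rewrite inE adj_irrefl.
rewrite xt /=; apply/andP; split; first by apply/set0Pn; exists x; rewrite !inE eqxx.
apply/completeP => u v; rewrite !inE => /orP[/eqP->|ut] /orP[/eqP->|vt] uv.
- by rewrite eqxx in uv.
- by have := tx _ vt; rewrite inE.
- by have := tx _ ut; rewrite inE adj_sym.
- exact: ct.
Qed.

Lemma card_trace sigma n :
  #|[set x | #|sigma :&: nbr x| == n]| =
  \sum_(tau : {set Gamma} | tau \subset sigma)
     (#|tau| == n) * #|pattern tau (sigma :\: tau)|.
Proof.
rewrite -sum1_card (partition_big (fun x => sigma :&: nbr x)
  (fun tau : {set Gamma} => tau \subset sigma)) => [|x _]; last exact: subsetIl.
apply: eq_bigr => tau ts; rewrite sum1_card.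
have [tn|tn] := eqVneq #|tau| n; rewrite ?mul1n ?mul0n; last first.
  apply: eq_card0 => x; rewrite unfold_in inE; apply: contraNF tn.
  by case/andP=> /eqP<- /eqP->.
apply: eq_card => x; rewrite unfold_in !inE.
have [sE|sE] := eqVneq (sigma :&: nbr x) tau.
  rewrite sE tn eqxx -sE subsetIr setDIr setDv set0U.
  by apply/esym/subsetP => y; rewrite !inE => /andP[].
rewrite andbF; apply/esym/negP => /andP[/subsetP tx /subsetP sx].
case/eqP: sE; apply/setP => y; rewrite inE.
apply/andP/idP => [[ys yx]|yt]; last by rewrite (subsetP ts) ?tx.
by apply: contraLR yx => yt; have := sx y; rewrite !inE yt ys => ->.
Qed.

(** * The linear coefficient of the f-polynomial *)

Lemma fpoly_coef1 : ((fpoly Gamma)`_1 = #|Gamma|%:R)%R.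
Proof.
have f0 : fnum Gamma 0 = #|Gamma|.
  rewrite /fnum -[RHS](card_imset predT (@set1_inj Gamma)); apply: eq_card => t.
  rewrite inE; apply/andP/imsetP => [[_ /cards1P[x ->]]|[x _ ->]]; first by exists x.
  rewrite cards1 inE; split=> //; apply/andP; split.
    by apply/set0Pn; exists x; rewrite inE.
  by apply/completeP => u v /set1P-> /set1P->; rewrite eqxx.
rewrite /fpoly coefD coef1 coef_sum add0r.
rewrite (eq_bigr (fun i : 'I__ =>
  if i == 0 :> nat then (#|Gamma|%:R : int) else 0)%R); last first.
  move=> i _; rewrite coefZ coefXn eqSS; case: (val i) => [|j].
    by rewrite f0 mulr1.
  by rewrite mulr0.
case: #|Gamma| => [|N]; first by rewrite big_ord0.
by rewrite big_ord_recl big1 ?addr0.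
Qed.

End Patterns.

(** * Counting continuations of a reduced word *)

Section ExposedCount.
Variable Gamma : sgraph.
Implicit Types (x y : Gamma) (l m k : letter Gamma) (s t : seq (letter Gamma)).

Definition supp s : {set Gamma} :=
  [set x | exposed (x, true) s || exposed (x, false) s].

Lemma exposed_supp m s : exposed m s -> m.1 \in supp s.
Proof. by case: m => x [] ms; rewrite inE ms ?orbT. Qed.

Lemma supp_cons l s : supp (l :: s) = l.1 |: (supp s :&: nbr l.1).
Proof.
apply/setP => y; rewrite !inE /= (adj_sym l.1).
have -> : (y == l.1) = (l == (y, true)) || (l == (y, false)).
  by case: l => x []; rewrite !xpair_eqE eq_sym ?andbT ?andbF ?orbF.
by case: (l == _); case: (l == _); case: (adj y _); rewrite ?orbT ?andbT ?andbF.
Qed.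

Lemma complete_supp s : complete (supp s).
Proof.
elim: s => [|l s /completeP IHs]; apply/completeP => u v; first by rewrite !inE.
have nbrE y x : (y \in nbr x) = adj x y by rewrite inE.
rewrite supp_cons !in_setU1 !in_setI !nbrE.
case/orP=> [/eqP->|/andP[us ul]] /orP[/eqP->|/andP[vs vl]].
- by rewrite eqxx.
- by [].
- by rewrite adj_sym.
- exact: IHs.
Qed.

Lemma exposed_inv m s : exposed m s -> ~~ exposed (inv_letter m) s.
Proof.
elim: s => //= l s IHs /orP[/eqP->|/andP[ml ms]].
  by rewrite adj_irrefl orbF /inv_letter; case: (m) => x []; rewrite xpair_eqE andbF.
rewrite (negPf (IHs ms)) andbF orbF.
by apply: contraTneq ml => ->; rewrite adj_irrefl.
Qed.

Lemma card_supp_cons l s : #|supp (l :: s)| = #|supp s :&: nbr l.1|.+1.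
Proof. by rewrite supp_cons cardsU1 !inE adj_irrefl andbF. Qed.

Lemma card_supp_nbr s x : x \in supp s -> #|supp s :&: nbr x|.+1 = #|supp s|.
Proof.
move=> xs; rewrite [RHS](cardsD1 x) xs add1n; congr _.+1; apply: eq_card => y.
rewrite !inE andbC; case ys: (_ || _); rewrite ?andbF // !andbT.
apply/idP/idP => [|yx]; first by apply: contraTneq => ->; rewrite adj_irrefl.
by have /completeP := complete_supp s; apply; rewrite // 1?eq_sym // inE.
Qed.

Lemma card_exposed s : #|[set l | exposed (inv_letter l) s]| = #|supp s|.
Proof.
rewrite -(@card_in_imset _ _ fst).
  apply: eq_card => x; apply/imsetP/idP => [[l]|].
    by rewrite inE => /exposed_supp xs ->.
  by rewrite inE => /orP[] xs; [exists (x, false)|exists (x, true)]; rewrite ?inE.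
move=> [x b] [y c]; rewrite !inE /inv_letter /= => xs ys xy; rewrite -xy in ys *.
case: (eqVneq b c) => [-> //|bc].
have := exposed_inv xs; rewrite /inv_letter /= negbK => /negP[].
by case: b c bc ys {xs} => [] [].
Qed.

(** Each vertex carries two letters.  Both may be read, except that a vertex of
[supp s] has exactly one refused letter, which would lead to a support of
the same size as [supp s]; the second summand counts the refused letters. *)
Lemma card_next_level s n :
  #|[set l | ~~ exposed (inv_letter l) s & #|supp (l :: s)| == n]|
    + (#|supp s| == n) * #|supp s|
  = #|[set x | #|supp s :&: nbr x|.+1 == n]| * 2.
Proof.
rewrite -card_bool -cardsT -cardsX.
rewrite -[RHS](cardsID [set l | exposed (inv_letter l) s]) addnC.
congr (_ + _); last first.
  apply: eq_card => l; rewrite !inE card_supp_cons andbT.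
  by case: l.
have [sn|sn] := eqVneq #|supp s| n; rewrite ?mul1n ?mul0n.
  rewrite -card_exposed; apply: eq_card => l; rewrite !inE andbT.
  case ls: (exposed _ _); rewrite ?andbF // card_supp_nbr ?sn ?eqxx //.
  exact: (exposed_supp ls).
apply/esym/eq_card0 => l; rewrite !inE andbT; apply: contraNF sn.
by case/andP=> /eqP<- /exposed_supp /card_supp_nbr->.
Qed.

Definition extensions s r : nat :=
  #|[set w : r.-tuple (letter Gamma) | reduced (catrev w s)]|.

Lemma extensions0 s : reduced s -> extensions s 0 = 1.
Proof.
move=> rs; rewrite /extensions -[RHS](card_tuple 0 (letter Gamma)).
by apply: eq_card => w; rewrite inE tuple0.
Qed.

Lemma extensionsS s r :
  extensions s r.+1 =
  \sum_(l | ~~ exposed (inv_letter l) s) extensions (l :: s) r.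
Proof.
rewrite /extensions -sum1_card (partition_big (@thead _ _)
  (fun l => ~~ exposed (inv_letter l) s)) /= => [|w]; last first.
  case/tupleP: w => l w; rewrite inE theadE.
  by move=> /(@reduced_catrev _ w (l :: s))/andP[].
apply: eq_bigr => l _; rewrite sum1_card.
have cons_inj : injective (fun w : r.-tuple (letter Gamma) => cons_tuple l w).
  by move=> u v /(congr1 val) [] /val_inj.
rewrite -[RHS](card_imset _ cons_inj); apply: eq_card => w.
rewrite unfold_in inE.
apply/andP/imsetP => [[]|[u]]; last first.
  by rewrite inE => ru ->; split=> //; rewrite theadE.
case/tupleP: w => k w; rewrite theadE => rw /eqP kl.
by exists w; rewrite ?inE -?kl.
Qed.

Lemma geodesic_growthE r :
  geodesic_growth (@raag_gen Gamma) r = extensions [::] r.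
Proof.
apply: eq_card => w; rewrite !inE; apply/asboolP/idP; by move/geodesicP.
Qed.

End ExposedCount.

(** * Comparing two graphs *)

Section TwoGraphs.
Variables Gamma1 Gamma2 : sgraph.
Hypothesis eq_common :
  forall (tau1 : {set Gamma1}) (tau2 : {set Gamma2}),
    complete tau1 -> complete tau2 -> #|tau1| = #|tau2| ->
  #|pattern tau1 set0| = #|pattern tau2 set0|.

(** Induction on the number [n] of forbidden neighbours: a vertex [y] of [rho]
is dropped, and [card_pattern_split] expresses the count as a difference of
two counts with [n - 1] forbidden neighbours. *)
Lemma eq_card_pattern n (tau1 rho1 : {set Gamma1}) (tau2 rho2 : {set Gamma2}) :
    complete (tau1 :|: rho1) -> complete (tau2 :|: rho2) ->
    [disjoint tau1 & rho1] -> [disjoint tau2 & rho2] ->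
    #|tau1| = #|tau2| -> #|rho1| = n -> #|rho2| = n ->
  #|pattern tau1 rho1| = #|pattern tau2 rho2|.
Proof.
elim: n tau1 rho1 tau2 rho2 => [|n IHn] tau1 rho1 tau2 rho2 c1 c2 d1 d2 eqt.
  move=> /cards0_eq r1 /cards0_eq r2.
  by move: c1 c2; rewrite r1 r2 !setU0 => c1 c2; exact: eq_common.
move=> n1 n2.
have [y1 y1r] : exists y, y \in rho1 by apply/card_gt0P; rewrite n1.
have [y2 y2r] : exists y, y \in rho2 by apply/card_gt0P; rewrite n2.
have aux (Gamma : sgraph) (tau rho : {set Gamma}) y :
    complete (tau :|: rho) -> [disjoint tau & rho] -> #|rho| = n.+1 ->
    y \in rho ->
  [/\ complete ((y |: tau) :|: rho :\ y),
      [disjoint tau & rho :\ y], [disjoint y |: tau & rho :\ y],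
      #|y |: tau| = #|tau|.+1 & #|rho :\ y| = n].
  move=> c d nr yr.
  have dy : [disjoint tau & rho :\ y].
    by apply: disjointWr d; exact: subsetDl.
  split=> //.
  - by rewrite setUAC setD1K // setUC.
  - by rewrite -setI_eq0 setIUl setU_eq0 !setI_eq0 dy disjoints1 !inE eqxx.
  - by rewrite cardsU1 (disjointFl d).
  - by apply/eqP; rewrite -eqSS -nr (cardsD1 y rho) yr.
have [c1b d1a d1b t1 r1] := aux _ _ _ _ c1 d1 n1 y1r.
have [c2b d2a d2b t2 r2] := aux _ _ _ _ c2 d2 n2 y2r.
have c1a := completeS (setSU _ (subsetUr _ _)) c1b.
have c2a := completeS (setSU _ (subsetUr _ _)) c2b.
have := card_pattern_split tau1 (rho1 :\ y1) y1.
rewrite (IHn tau1 _ tau2 (rho2 :\ y2)) // (card_pattern_split _ _ y2) !setD1K //.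
rewrite (IHn (y1 |: tau1) _ (y2 |: tau2) (rho2 :\ y2)) ?t1 ?t2 ?eqt //.
by move/addnI.
Qed.

Lemma eq_card_trace (sigma1 : {set Gamma1}) (sigma2 : {set Gamma2}) n :
    complete sigma1 -> complete sigma2 -> #|sigma1| = #|sigma2| ->
  #|[set x | #|sigma1 :&: nbr x| == n]| = #|[set x | #|sigma2 :&: nbr x| == n]|.
Proof.
move=> c1 c2 eqs; rewrite !card_trace.
apply: (@eq_sum_levels _ _ _ _ (fun t : {set Gamma1} => #|t|)
          (fun t : {set Gamma2} => #|t|)) => [j|t1 t2 s1 s2 eqt].
  by rewrite !cards_draws eqs.
rewrite eqt; congr (_ * _).
have compl (Gamma : sgraph) (tau sigma : {set Gamma}) : tau \subset sigma ->
    [/\ tau :|: sigma :\: tau = sigma, [disjoint tau & sigma :\: tau]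
      & #|sigma :\: tau| = #|sigma| - #|tau|].
  move=> ts; split; last by rewrite cardsDS.
    by rewrite -{1}(setIidPr ts) setID.
  by rewrite -setI_eq0 setIDA setDIl setDv set0I.
have [U1 D1 C1] := compl _ _ _ s1; have [U2 D2 C2] := compl _ _ _ s2.
by apply: (@eq_card_pattern (#|sigma2| - #|t2|)) => //;
  rewrite ?U1 ?U2 ?C1 ?eqs ?eqt.
Qed.

(** The letters that may follow are compared by the size of the support they
lead to, so that no correspondence between the two graphs is needed. *)
Lemma eq_extensions r (s1 : seq (letter Gamma1)) (s2 : seq (letter Gamma2)) :
    reduced s1 -> reduced s2 -> #|supp s1| = #|supp s2| ->
  extensions s1 r = extensions s2 r.
Proof.
elim: r s1 s2 => [|r IHr] s1 s2 rs1 rs2 eqs; first by rewrite !extensions0.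
rewrite !extensionsS.
apply: (@eq_sum_levels _ _ _ _ (fun l => #|supp (l :: s1)|)
                               (fun l => #|supp (l :: s2)|)).
  move=> n; apply: (@addIn ((#|supp s1| == n) * #|supp s1|)).
  rewrite card_next_level eqs card_next_level; congr (_ * 2).
  case: n => [|n]; first by rewrite !eq_card0 // => x; rewrite inE.
  by apply: eq_card_trace; rewrite ?complete_supp.
by move=> l1 l2 ok1 ok2; apply: IHr; rewrite /= ?ok1 ?ok2.
Qed.

End TwoGraphs.

Theorem corollary3p10 (Gamma1 Gamma2 : sgraph)
    (same_fpoly : fpoly Gamma1 = fpoly Gamma2)
    (same_link : forall (sigma1 : {set Gamma1}) (sigma2 : {set Gamma2}),
       sigma1 \in cliques Gamma1 -> sigma2 \in cliques Gamma2 ->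
       #|sigma1| = #|sigma2| -> #|link sigma1| = #|link sigma2|) :
  forall r : nat,
    geodesic_growth (@raag_gen Gamma1) r = geodesic_growth (@raag_gen Gamma2) r.
Proof.
move=> r; rewrite !geodesic_growthE; apply: eq_extensions => //; last first.
  by rewrite !eq_card0 // => x; rewrite inE.
move=> tau1 tau2 c1 c2 eqt.
have [t0|t0] := eqVneq tau1 set0.
  have /cards0_eq t20 : #|tau2| = 0 by rewrite -eqt t0 cards0.
  have patT (Gamma : sgraph) : #|pattern (set0 : {set Gamma}) set0| = #|Gamma|.
    by apply: eq_card => x; rewrite !inE !sub0set.
  rewrite t0 t20 !patT; have := congr1 (fun p : {poly int} => p`_1)%R same_fpoly.
  by rewrite !fpoly_coef1 => /eqP; rewrite eqr_nat => /eqP.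
have t20 : tau2 != set0 by rewrite -card_gt0 -eqt card_gt0.
by rewrite !pattern_link //; apply: same_link; rewrite // inE ?t0 ?t20.
Qed.
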